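(* Let $\mathcal{SLG}$ be the collection of all semigroup semilattices of groups, and let $\mathcal{SLWQ}$ be the collection of all groupoids $(S,* )$ that are semigroup semilattices $Y$ of Ward quasigroups $(W_\alpha, *|_{W_\alpha}, e_\alpha)$ $(\alpha\in Y)$ and that satisfy the identity $$(x*y)*(z*w) = \left[x*(w^{-1}*y^{-1})\right]*z \qquad (x,y,z,w\in S).$$ There is a one-to-one correspondence between $\mathcal{SLG}$ and $\mathcal{SLWQ}$. Also, a groupoid $(S,* )$ belongs to $\mathcal{SLWQ}$ if and only if there exists $(S,\bullet)\in\mathcal{SLG}$ (on the same set $S$) such that $x*y = x\bullet y^{-1}$ for all $x,y\in S$, where here $y^{-1}$ is the inverse of $y$ in the group (component of $(S,\bullet)$) to which it belongs.
   Context: A groupoid $(S,* )$ is a set $S$ with a binary operation $*$. A semigroup semilattice $Y$ is a commutative semigroup all of whose elements are idempotent; its product is written $\alpha\beta$. A groupoid $(S,* )$ is a semigroup semilattice $Y$ of groupoids $(T_\alpha,*|_{T_\alpha})$ $(\alpha\in Y)$ if $Y$ is a semigroup semilattice, $S$ is the disjoint union of the nonempty subsets $T_\alpha$ and $T_\alpha * T_\beta\subseteq T_{\alpha\beta}$ for all $\alpha,\beta\in Y$ ($*$ itself need not be associative). A semigroup semilattice of groups is a semigroup $(S,\bullet)$ (so $\bullet$ is associative) that is a semigroup semilattice $Y$ of groupoids each of which is a group $(G_\alpha,\bullet|_{G_\alpha},e_\alpha)$ with identity $e_\alpha$. A quasigroup is a groupoid in which, for all $a,b$, the equations $a*x=b$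 and $y*a=b$ have unique solutions. A Ward quasigroup is a (nonempty) quasigroup satisfying $(x*z)*(y*z)=x*y$; it has a unique right identity element $e$, and $x*x=e$ for all $x$; it is then written $(W,*,e)$. An inverse groupoid is a groupoid $(S,* )$ such that for each $x$ there is a unique $x^{-1}\in S$ with $(x*x^{-1})*x=x$ and $(x^{-1}*x)*x^{-1}=x^{-1}$. A semigroup semilattice of Ward quasigroups is an inverse groupoid, with $x^{-1}=e_\alpha*x$ for $x\in W_\alpha$; this is the meaning of $^{-1}$ in the identity defining $\mathcal{SLWQ}$. Two collections of structures are in one-to-one correspondence when there are mutually inverse assignments between them preserving the underlying set, i.e. for every set $S$ a bijection between the structures on $S$ of one kind and those of the other (indexings by $Y$ being considered up to relabelling). *)

(* Defs.v *)
From mathcomp Require Import all_boot.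
From mathcomp Require Import boolp classical_sets.
From Stdlib Require ClassicalEpsilon.

Set Implicit Arguments.
Unset Strict Implicit.
Unset Printing Implicit Defensive.

Local Open Scope classical_set_scope.

(* A groupoid is a type S with an operation op : S -> S -> S. The predicates
   on a subset A below refer to the restriction of op to A. *)

Definition subgroupoid (S : Type) (op : S -> S -> S) (A : set S) : Prop :=
  forall x y, A x -> A y -> A (op x y).

Definition is_inverse_in (S : Type) (op : S -> S -> S) (A : set S) (e y y' : S)
  : Prop := [/\ A y', op y y' = e & op y' y = e].

Definition is_group (S : Type) (op : S -> S -> S) (A : set S) (e : S) : Prop :=
  [/\ subgroupoid op A,
      forall x y z, A x -> A y -> A z -> op x (op y z) = op (op x y) z,
      A e,
      forall x, A x -> op e x = x /\ op x e = x
    & forall x, A x -> exists x', is_inverse_in op A e x x'].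

Definition is_quasigroup (S : Type) (op : S -> S -> S) (A : set S) : Prop :=
  subgroupoid op A /\
  forall a b, A a -> A b ->
    (exists! x, A x /\ op a x = b) /\ (exists! y, A y /\ op y a = b).

Definition is_ward_quasigroup (S : Type) (op : S -> S -> S) (A : set S)
  : Prop :=
  [/\ A !=set0,
      is_quasigroup op A
    & forall x y z, A x -> A y -> A z -> op (op x z) (op y z) = op x y].

Definition is_semigroup_semilattice (Y : Type) (m : Y -> Y -> Y) : Prop :=
  [/\ associative m, commutative m & idempotent_op m].

(* [partition] includes the nonemptiness of every T a. *)
Definition is_semilattice_decomposition (S Y : Type) (op : S -> S -> S)
    (m : Y -> Y -> Y) (T : Y -> set S) : Prop :=
  [/\ is_semigroup_semilattice m,
      partition setT T setT
    & forall a b x y, T a x -> T b y -> T (m a b) (op x y)].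

Definition is_semilattice_of_groups (S Y : Type) (op : S -> S -> S)
    (m : Y -> Y -> Y) (G : Y -> set S) (e : Y -> S) : Prop :=
  [/\ associative op,
      is_semilattice_decomposition op m G
    & forall a, is_group op (G a) (e a)].

Definition is_semilattice_of_ward_quasigroups (S Y : Type) (op : S -> S -> S)
    (m : Y -> Y -> Y) (W : Y -> set S) : Prop :=
  is_semilattice_decomposition op m W /\
  forall a, is_ward_quasigroup op (W a).

(* The inverse of x in an inverse groupoid: the unique x' satisfying both
   equations. It is a junk value if no such x' exists, which does not happen in
   a semilattice of Ward quasigroups. *)
Definition groupoid_inv (S : Type) (op : S -> S -> S) (x : S) : S :=
  ClassicalEpsilon.epsilon (inhabits x)
    (fun x' => op (op x x') x = x /\ op (op x' x) x' = x').

Definition is_SLG (S : Type) (op : S -> S -> S) : Prop :=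
  exists (Y : Type) (m : Y -> Y -> Y) (G : Y -> set S) (e : Y -> S),
    is_semilattice_of_groups op m G e.

Definition is_SLWQ (S : Type) (op : S -> S -> S) : Prop :=
  (exists (Y : Type) (m : Y -> Y -> Y) (W : Y -> set S),
     is_semilattice_of_ward_quasigroups op m W) /\
  forall x y z w : S,
    op (op x y) (op z w) =
    op (op x (op (groupoid_inv op w) (groupoid_inv op y))) z.

(* The indexing semilattice is not part of a structure: the components are
   determined by op, since x and y lie in the same one iff they have the same
   identity element (SLG), respectively iff op x x = op y y (SLWQ). *)
Definition SLG (S : Type) : Type := {op : S -> S -> S | is_SLG op}.
Definition SLWQ (S : Type) : Type := {op : S -> S -> S | is_SLWQ op}.

(* Main.v *)
Require Import Defs.
From mathcomp Require Import all_boot.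
From mathcomp Require Import boolp classical_sets.
From Stdlib Require ClassicalEpsilon.

Set Implicit Arguments.
Unset Strict Implicit.
Unset Printing Implicit Defensive.

(** A Clifford semigroup and its semilattice of Ward quasigroups determine each
    other by one and the same involution: replace the product [x y] by
    [x y^-1].  Both structures are inverse groupoids whose components are
    cancellative, so [y^-1] is the same in both.  The only real work is the
    associativity of [x * y^-1] on the Ward side: the displayed identity, applied
    to the units [e_a], first gives [e_a * e_b = e_ab], then that [x * y]
    depends only on the images of [x] and [y] in the component of [x * y], and
    finally [(x * y)^-1 = y * x] and [(x * y) * w^-1 = x * (w^-1 * y^-1)]. *)

Definition twist (S : Type) (op : S -> S -> S) (x y : S) : S :=
  op x (groupoid_inv op y).

Definition cancellative_in (S : Type) (op : S -> S -> S) (A : set S) : Prop :=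
  (forall x y z, A x -> A y -> A z -> op x y = op x z -> y = z) /\
  (forall x y z, A x -> A y -> A z -> op y x = op z x -> y = z).

(** * Components of a semilattice decomposition, and the generalised inverse *)

Section Decomposition.
Context (S Y : Type) (op : S -> S -> S) (m : Y -> Y -> Y) (T : Y -> set S).
Hypothesis dec : is_semilattice_decomposition op m T.

Lemma decompositionM {a b x y} : T a x -> T b y -> T (m a b) (op x y).
Proof. by case: dec => _ _; apply. Qed.

Lemma decomposition_cover x : exists a, T a x.
Proof.
case: dec => _ [cov _ _] _.
have : setT x by [].
by rewrite -cov => -[a _ Tax]; exists a.
Qed.

Lemma decomposition_inj {a b x} : T a x -> T b x -> a = b.
Proof. by case: dec => _ [_ triv _] _ Ta Tb; apply: triv => //; exists x. Qed.

Lemma decomposition_subgroupoid a : subgroupoid op (T a).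
Proof.
by case: dec => -[_ _ mid] _ _ x y Tx Ty; rewrite -(mid a); exact: decompositionM.
Qed.

(** The value [z] chosen by [epsilon] might lie in another component [T b]. But [xzx = x] forces
    [m a b = a] and [zxz = z] forces [m a b = b], so [z] lies in [T a], where cancelling [x] on both
    sides gives [z = x']. *)
Lemma groupoid_invE a x x' : cancellative_in op (T a) -> T a x -> T a x' ->
  op (op x x') x = x -> op (op x' x) x' = x' -> groupoid_inv op x = x'.
Proof.
case=> canl canr Tx Tx' xx'x x'xx'; rewrite /groupoid_inv.
have [|] := ClassicalEpsilon.epsilon_spec (inhabits x)
  (fun z => op (op x z) x = x /\ op (op z x) z = z); first by exists x'.
set z := ClassicalEpsilon.epsilon _ _ => xzx zxz.
have [b Tz] := decomposition_cover z.
case: (dec) => -[mA mC mid] _ _.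
have ab : m a b = a.
  have := decompositionM (decompositionM Tx Tz) Tx.
  by rewrite xzx => /(decomposition_inj Tx) {2}->; rewrite (mC _ a) mA mid.
have ba : m a b = b.
  have := decompositionM (decompositionM Tz Tx) Tz.
  rewrite zxz => /(decomposition_inj Tz) {2}->.
  by rewrite (mC (m b a)) mA mid mC.
have {}Tz : T a z by rewrite -ab ba.
have sub := @decomposition_subgroupoid a.
apply: (canl x) => //; apply: (canr x) => //; [exact: sub|exact: sub|].
by rewrite xzx.
Qed.

End Decomposition.

(** * From semilattices of groups to semilattices of Ward quasigroups *)

Section SemilatticeOfGroups.
Context (S Y : Type) (op : S -> S -> S) (m : Y -> Y -> Y) (G : Y -> set S).
Context (e : Y -> S).
Hypothesis slg : is_semilattice_of_groups op m G e.

Local Notation "x * y" := (op x y).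
Local Notation inv := (groupoid_inv op).

Let opA : associative op. Proof. by case: slg. Qed.
Let dec : is_semilattice_decomposition op m G. Proof. by case: slg. Qed.
Let mA : associative m. Proof. by case: dec => -[]. Qed.
Let mC : commutative m. Proof. by case: dec => -[]. Qed.
Let mid : idempotent_op m. Proof. by case: dec => -[]. Qed.
Let GM {a b x y} : G a x -> G b y -> G (m a b) (x * y).
Proof. exact: (decompositionM dec). Qed.
Let Ge a : G a (e a). Proof. by case: slg => _ _ /(_ a)[]. Qed.
Let mul1 {a x} : G a x -> e a * x = x.
Proof. by case: slg => _ _ /(_ a)[_ _ _ h _] /h[]. Qed.
Let mulr1 {a x} : G a x -> x * e a = x.
Proof. by case: slg => _ _ /(_ a)[_ _ _ h _] /h[]. Qed.

Lemma group_cancellative a : cancellative_in op (G a).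
Proof.
case: slg => _ _ /(_ a)[_ _ _ _ ginv].
split=> x y z Gx Gy Gz; have [x' [_ xx' x'x]] := ginv _ Gx.
  by move=> /(congr1 (op x')); rewrite !opA x'x !mul1.
by move=> /(congr1 (op^~ x')); rewrite -!opA xx' !mulr1.
Qed.

Lemma group_invE {a x x'} :
  G a x -> is_inverse_in op (G a) (e a) x x' -> inv x = x'.
Proof.
move=> Gx [Gx' xx' x'x]; apply: (groupoid_invE dec (@group_cancellative a)) => //.
  by rewrite xx' mul1.
by rewrite x'x mul1.
Qed.

Lemma group_inv {a x} : G a x -> is_inverse_in op (G a) (e a) x (inv x).
Proof.
move=> Gx; case: slg => _ _ /(_ a)[_ _ _ _ /(_ x Gx)[x' xx']].
by rewrite (group_invE Gx xx').
Qed.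

Lemma group_invK : involutive inv.
Proof.
move=> x; have [a Gx] := decomposition_cover dec x.
by have [Gx' xx' x'x] := group_inv Gx; apply: (group_invE Gx').
Qed.

Lemma idempotent_group_unit {a x} : G a x -> x * x = x -> x = e a.
Proof.
move=> Gx xx; case: (@group_cancellative a) => canl _.
by apply: (canl x) => //; rewrite xx mulr1.
Qed.

(** When [d] lies below [c], the product [e c * e d] is an idempotent of the group [G d], hence its
    unit. The general case follows on multiplying by [e (m a b)] on the right. *)
Lemma group_unitM a b : e a * e b = e (m a b).
Proof.
have le c d : m c d = d -> e c * e d = e d.
  move=> cd; have Gcd : G d (e c * e d) by rewrite -{1}cd; exact: GM.
  apply: idempotent_group_unit => //.
  by rewrite -opA (mul1 Gcd) opA (mul1 (Ge c)).
rewrite -(mulr1 (GM (Ge a) (Ge b))) -opA.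
by rewrite !le // ?mA ?mid // (mC b) -mA mid.
Qed.

(** In both products [e a] may be replaced by [f = e (m a b)]; as [f * x] and [x * f] lie in the
    group with unit [f], both equal [f * x * f]. *)
Lemma group_unit_central a x : e a * x = x * e a.
Proof.
have [b Gx] := decomposition_cover dec x.
have Gl : G (m a b) (e (m a b) * x).
  by move: (GM (Ge (m a b)) Gx); rewrite -mA mid.
have Gr : G (m a b) (x * e (m a b)).
  by move: (GM Gx (Ge (m a b))); rewrite mC -mA mid.
have -> : e a * x = e (m a b) * x by rewrite -group_unitM -opA (mul1 Gx).
have -> : x * e a = x * e (m a b).
  by rewrite mC -group_unitM opA (mulr1 Gx).
by rewrite -(mulr1 Gl) -opA (mul1 Gr).
Qed.

Lemma group_invM x y : inv (x * y) = inv y * inv x.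
Proof.
have [a Gx] := decomposition_cover dec x.
have [b Gy] := decomposition_cover dec y.
have [Gx' xx' x'x] := group_inv Gx; have [Gy' yy' y'y] := group_inv Gy.
apply: (group_invE (GM Gx Gy)); split; first by rewrite mC; exact: GM.
  by rewrite opA -(opA x) yy' -group_unit_central -opA xx' group_unitM mC.
by rewrite opA -(opA (inv y)) x'x -group_unit_central -opA y'y group_unitM.
Qed.

Lemma twist_semilattice_of_ward_quasigroups :
  is_semilattice_of_ward_quasigroups (twist op) m G.
Proof.
have G' a x : G a x -> G a (inv x) by move=> /group_inv[].
split.
  case: dec => sl part _; split=> // a b x y Gx Gy.
  by apply: GM => //; exact: G'.
have sub a x y : G a x -> G a y -> G a (x * y).
  by exact: (decomposition_subgroupoid dec).
move=> a; split; first by exists (e a).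
  split=> [x y Gx Gy|x y Gx Gy]; first by apply: sub => //; exact: G'.
  have [Gx' xx' x'x] := group_inv Gx; rewrite /twist; split.
    (* The solution [z] of [x * inv z = y]. *)
    exists (inv y * x); split.
      split; first by apply: sub => //; exact: G'.
      by rewrite group_invM group_invK opA xx' mul1.
    move=> z [Gz <-]; rewrite group_invM group_invK -opA x'x.
    by rewrite mulr1.
  (* The solution [z] of [z * inv x = y]. *)
  exists (y * x); split.
    by split; [exact: sub|rewrite -opA xx' mulr1].
  by move=> z [Gz <-]; rewrite -opA x'x mulr1.
move=> x y z Gx Gy Gz; rewrite /twist group_invM group_invK.
have [Gz' _ z'z] := group_inv Gz.
by rewrite opA -(opA x) z'z (mulr1 Gx).
Qed.

End SemilatticeOfGroups.

(** * From semilattices of Ward quasigroups to semilattices of groups *)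

Section SemilatticeOfWardQuasigroups.
Context (S Y : Type) (op : S -> S -> S) (m : Y -> Y -> Y) (W : Y -> set S).
Hypothesis slwq : is_semilattice_of_ward_quasigroups op m W.

Local Notation "x * y" := (op x y).
Local Notation inv := (groupoid_inv op).

Let dec : is_semilattice_decomposition op m W. Proof. by case: slwq. Qed.
Let mA : associative m. Proof. by case: dec => -[]. Qed.
Let mC : commutative m. Proof. by case: dec => -[]. Qed.
Let mid : idempotent_op m. Proof. by case: dec => -[]. Qed.
Let WM {a b x y} : W a x -> W b y -> W (m a b) (x * y).
Proof. exact: (decompositionM dec). Qed.
Let WMl a x y : W a x -> W a y -> W a (x * y).
Proof. exact: (decomposition_subgroupoid dec). Qed.
Let wardE {a x y z} : W a x -> W a y -> W a z -> (x * z) * (y * z) = x * y.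
Proof. by case: slwq => _ /(_ a)[_ _]; apply. Qed.

Lemma ward_cancellative a : cancellative_in op (W a).
Proof.
case: slwq => _ /(_ a)[_ [_ quasi] _].
split=> x y z Wx Wy Wz.
  have [[t [_ uniq_t]] _] := quasi _ _ Wx (WMl Wx Wy).
  by move=> xyz; rewrite -(uniq_t y) // -(uniq_t z).
have [_ [t [_ uniq_t]]] := quasi _ _ Wx (WMl Wy Wx).
by move=> xyz; rewrite -(uniq_t y) // -(uniq_t z).
Qed.

(** Every [y] of the component is some [x * z], and the Ward law turns [(x * z) * (x * z)] into
    [x * x]. Choice then collects the units into one function. *)
Lemma ward_unit_ex : exists e : Y -> S, forall a x, W a x -> x * x = e a.
Proof.
suff /choice[e he] a : exists u, forall x, W a x -> x * x = u by exists e.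
case: slwq => _ /(_ a)[[x Wx] [_ quasi] _]; exists (x * x) => y Wy.
have [[z [[Wz <-] _]] _] := quasi _ _ Wx Wy.
exact: (wardE Wx Wx Wz).
Qed.

Context (e : Y -> S).
Hypothesis xxe : forall a x, W a x -> x * x = e a.

Let We a : W a (e a).
Proof.
by case: slwq => _ /(_ a)[[x Wx] _ _]; rewrite -(xxe Wx); exact: WMl.
Qed.

Lemma ward_mulr1 {a x} : W a x -> x * e a = x.
Proof.
move=> Wx; case: slwq => _ /(_ a)[_ [_ quasi] _].
have [[y [[Wy <-] _]] _] := quasi _ _ Wx Wx.
by rewrite -(xxe Wy) (wardE Wx Wy Wy).
Qed.

Lemma ward_unitC a x y : W a x -> W a y -> e a * (x * y) = y * x.
Proof. by move=> Wx Wy; rewrite -(xxe Wy) (wardE Wy Wx Wy). Qed.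

Lemma ward_unitK a x : W a x -> e a * (e a * x) = x.
Proof. by move=> Wx; rewrite ward_unitC // ward_mulr1. Qed.

Lemma ward_invE {a x} : W a x -> inv x = e a * x.
Proof.
move=> Wx; have Wex : W a (e a * x) by exact: WMl.
apply: (groupoid_invE dec (@ward_cancellative a)) => //.
  by rewrite -[X in _ * X](ward_unitK Wx) (wardE Wx (We a) Wex) ward_mulr1.
by rewrite (wardE Wex (We a) Wx) ward_mulr1.
Qed.

Lemma ward_invW a x : W a x -> W a (inv x).
Proof. by move=> Wx; rewrite (ward_invE Wx); exact: WMl. Qed.

Lemma ward_invK : involutive inv.
Proof.
move=> x; have [a Wx] := decomposition_cover dec x.
by rewrite (ward_invE (ward_invW Wx)) (ward_invE Wx) ward_unitK.
Qed.

Lemma ward_inv_unit a : inv (e a) = e a.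
Proof. by rewrite (ward_invE (We a)) (xxe (We a)). Qed.

(** * Consequences of the displayed identity across components *)

Hypothesis slwq_id : forall x y z w,
  (x * y) * (z * w) = (x * (inv w * inv y)) * z.

Let WMr {a c x y} : m a c = c -> W a x -> W c y -> W c (x * y).
Proof. by move=> ac Wx Wy; rewrite -ac; exact: WM. Qed.
Let WMr' {a c x y} : m a c = c -> W c x -> W a y -> W c (x * y).
Proof. by move=> ac Wx Wy; rewrite -ac mC; exact: WM. Qed.

(** The identity makes the square of [e c * e a], which is [e c], equal to [e c * e a] itself. *)
Lemma ward_unit_ler a c : m a c = c -> e c * e a = e c.
Proof.
move=> ac; have Wca := WMr' ac (We c) (We a).
have := slwq_id (e c) (e a) (e c) (e a).
by rewrite ward_inv_unit (xxe Wca) (xxe (We a)) ward_mulr1.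
Qed.

Lemma ward_mulr_unit_le a c x : m a c = c -> W c x -> x * e a = x.
Proof.
move=> ac Wx; have := slwq_id x (e a) (e c) (e c).
rewrite !ward_inv_unit (xxe (We c)) (ward_unit_ler ac) (ward_mulr1 Wx).
by rewrite (ward_mulr1 Wx) (ward_mulr1 (WMr' ac Wx (We a))).
Qed.

(** Squaring works again, but leaves a right factor [e a] on an element of [W c];
    [ward_mulr_unit_le] removes it. *)
Lemma ward_unit_lel a c : m a c = c -> e a * e c = e c.
Proof.
move=> ac; have Wac := WMr ac (We a) (We c).
have := slwq_id (e a) (e c) (e a) (e c).
by rewrite ward_inv_unit (xxe Wac) (xxe (We c)) (ward_mulr_unit_le ac Wac).
Qed.

Let lel a b : m a (m a b) = m a b. Proof. by rewrite mA mid. Qed.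
Let ler a b : m b (m a b) = m a b. Proof. by rewrite (mC a) mA mid. Qed.

Lemma ward_unitM a b : e a * e b = e (m a b).
Proof.
have := slwq_id (e a) (e b) (e (m a b)) (e (m a b)).
rewrite !ward_inv_unit (xxe (We _)) (ward_unit_ler (ler a b)).
rewrite (ward_unit_lel (lel a b)) (xxe (We _)).
by rewrite (ward_mulr1 (WM (We a) (We b))).
Qed.

(** The right factor matters only through its image in the component of the product: in group terms
    [e (m a b) * inv y] is the unit of that component times [y]. *)
Lemma ward_mul_unit_inv a b x y : W a x -> W b y ->
  x * (e (m a b) * inv y) = x * y.
Proof.
move=> Wx Wy; have := slwq_id x y (e (m a b)) (e (m a b)).
have We'y := WMr' (ler a b) (We (m a b)) (ward_invW Wy).
rewrite ward_inv_unit (xxe (We _)) (ward_mulr1 (WM Wx Wy)).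
by rewrite (ward_mulr1 (WMr (lel a b) Wx We'y)).
Qed.

Lemma ward_unit_mul_unit c y : e c * (y * e c) = e c * y.
Proof.
by have := slwq_id (e c) (e c) y (e c); rewrite ward_inv_unit !(xxe (We c)).
Qed.

(* [y * e c] is the image of [y] in the lower component [W c]. *)
Lemma ward_mulr_unit b c y : m b c = c -> W b y -> y * e c = e c * inv y.
Proof.
move=> bc Wy; have [canl _] := @ward_cancellative c.
apply: (canl (e c)) => //; [exact: (WMr bc Wy)|exact: (WMr' bc _ (ward_invW Wy))|].
have := ward_mul_unit_inv (We c) Wy.
by rewrite mC bc ward_unit_mul_unit.
Qed.

(** The same reduction for the left factor: put units for [y] and [w] in the identity, whose right
    side then contains [e b * e a]. *)
Lemma ward_mul_unitl a b x y : W a x -> W b y -> (x * e (m a b)) * y = x * y.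
Proof.
move=> Wx Wy; have := slwq_id x (e a) y (e b).
by rewrite !ward_inv_unit ward_unitM (mC b) (ward_mulr1 Wx) (ward_mulr1 Wy).
Qed.

Lemma ward_invM x y : inv (x * y) = y * x.
Proof.
have [a Wx] := decomposition_cover dec x.
have [b Wy] := decomposition_cover dec y.
(* With this unit in the first two places the left side is [inv (x * y)]; the right side reduces to
   the image of [y] times [x]. *)
have := slwq_id (e (m a b)) (e (m a b)) x y.
rewrite ward_inv_unit (xxe (We _)) -(ward_invE (WM Wx Wy)) => ->.
rewrite ward_unit_mul_unit -(ward_mulr_unit (ler a b) Wy).
by rewrite mC ward_mul_unitl.
Qed.

(** This is associativity of the twisted product in disguise. Taking for [z] the unit of the
    component of the whole product makes it vanish on the right, while on the left
    [ward_mul_unit_inv] absorbs it. *)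
Lemma ward_mul_inv x y w : x * (inv w * inv y) = (x * y) * inv w.
Proof.
have [a Wx] := decomposition_cover dec x.
have [b Wy] := decomposition_cover dec y.
have [d Ww] := decomposition_cover dec w.
have := slwq_id x y (e (m (m a b) d)) w.
have := WM Wx (WM (ward_invW Ww) (ward_invW Wy)).
rewrite (mC d) mA => Wxwy; rewrite (ward_mulr1 Wxwy) => <-.
by rewrite -(ward_mul_unit_inv (WM Wx Wy) (ward_invW Ww)) ward_invK.
Qed.

Lemma twist_semilattice_of_groups :
  is_semilattice_of_groups (twist op) m W e.
Proof.
have twA : associative (twist op).
  by move=> x y z; rewrite /twist ward_invM -ward_mul_inv ward_invK.
split=> //.
  case: dec => sl part _; split=> // a b x y Wx Wy.
  by apply: WM => //; exact: ward_invW.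
move=> a; split; rewrite /twist.
- by move=> x y Wx Wy; apply: WMl => //; exact: ward_invW.
- by move=> x y z _ _ _; exact: twA.
- exact: We.
- move=> x Wx; rewrite ward_inv_unit (ward_mulr1 Wx) (ward_invE Wx).
  by rewrite ward_unitK.
- move=> x Wx; exists (inv x); split; first exact: ward_invW.
    by rewrite ward_invK (xxe Wx).
  by rewrite (xxe (ward_invW Wx)).
Qed.

End SemilatticeOfWardQuasigroups.

(** * The twist as an involution exchanging the two classes *)

Lemma groupoid_inv_twist_SLG (S : Type) (bul : S -> S -> S) :
  is_SLG bul -> groupoid_inv (twist bul) =1 groupoid_inv bul.
Proof.
case=> Y [m [G [e slg]]] x.
have slwq := twist_semilattice_of_ward_quasigroups slg.
have [dec _] := slwq; have [a Gx] := decomposition_cover dec x.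
have [Gx' xx' x'x] := group_inv slg Gx.
case: slg (slg) => bulA _ /(_ a)[_ _ _ mul1 _] slg.
(* The group inverse is a generalised inverse for the twist too: [x] twisted with [inv x] is the
   square of [x], and twisting by [x] cancels one factor. *)
apply: (groupoid_invE dec (ward_cancellative slwq a) Gx Gx').
  by rewrite /twist (group_invK slg) -bulA xx'; case: (mul1 _ Gx).
by rewrite /twist (group_invK slg) -bulA x'x; case: (mul1 _ Gx').
Qed.

Lemma twist_SLGK (S : Type) (bul : S -> S -> S) :
  is_SLG bul -> twist (twist bul) = bul.
Proof.
move=> slg; apply/funext => x; apply/funext => y.
rewrite {1}/twist groupoid_inv_twist_SLG // /twist.
by case: slg => Y [m [G [e slg]]]; rewrite (group_invK slg).
Qed.

Lemma twist_SLG (S : Type) (bul : S -> S -> S) :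
  is_SLG bul -> is_SLWQ (twist bul).
Proof.
move=> slg; split.
  case: slg => Y [m [G [e slg]]]; exists Y, m, G.
  exact: (twist_semilattice_of_ward_quasigroups slg).
move=> x y z w; rewrite !groupoid_inv_twist_SLG // /twist.
case: slg => Y [m [G [e slg]]]; case: (slg) => bulA _ _.
by rewrite !(group_invM slg) !(group_invK slg) !bulA.
Qed.

(** Inverses survive the twist because [x] twisted with [inv x] is [x * x], the unit of its
    component. *)
Lemma SLWQ_twist_semilattice_of_groups (S : Type) (op : S -> S -> S) :
  is_SLWQ op -> exists (Y : Type) (m : Y -> Y -> Y) (G : Y -> set S) e,
    [/\ is_semilattice_of_groups (twist op) m G e,
        involutive (groupoid_inv op)
      & groupoid_inv (twist op) =1 groupoid_inv op].
Proof.
case=> -[Y [m [W slwq]]] slwq_id; have [e xxe] := ward_unit_ex slwq.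
have slg := twist_semilattice_of_groups slwq xxe slwq_id.
have invK := ward_invK slwq xxe.
exists Y, m, W, e; split=> // x.
have [a Wx] := decomposition_cover (proj1 slwq) x.
have Wx' := ward_invW slwq xxe Wx.
apply: (group_invE slg Wx); split=> //; rewrite /twist ?invK.
  exact: xxe.
exact: xxe.
Qed.

Lemma twist_SLWQ (S : Type) (op : S -> S -> S) :
  is_SLWQ op -> is_SLG (twist op).
Proof.
move=> /SLWQ_twist_semilattice_of_groups[Y [m [G [e [slg _ _]]]]].
by exists Y, m, G, e.
Qed.

Lemma twist_SLWQK (S : Type) (op : S -> S -> S) :
  is_SLWQ op -> twist (twist op) = op.
Proof.
move=> /SLWQ_twist_semilattice_of_groups[Y [m [G [e [_ invK inv_tw]]]]].
by apply/funext => x; apply/funext => y; rewrite {1}/twist inv_tw /twist invK.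
Qed.

Theorem corollary3p6 :
  (exists (F : forall S : Type, SLG S -> SLWQ S)
          (H : forall S : Type, SLWQ S -> SLG S),
      forall S : Type, cancel (F S) (H S) /\ cancel (H S) (F S)) /\
  (forall (S : Type) (op : S -> S -> S),
      is_SLWQ op <->
      exists bul : S -> S -> S,
        is_SLG bul /\
        exists (Y : Type) (m : Y -> Y -> Y) (G : Y -> set S) (e : Y -> S),
          is_semilattice_of_groups bul m G e /\
          forall (a : Y) (x y y' : S),
            G a y -> is_inverse_in bul (G a) (e a) y y' -> op x y = bul x y').
Proof.
split.
  exists (fun S s => exist _ _ (twist_SLG (proj2_sig s))).
  exists (fun S s => exist _ _ (twist_SLWQ (proj2_sig s))).
  (* Proof irrelevance leaves only the equality of operations. *)
  move=> S; split=> -[op hop]; apply: eq_exist => /=.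
    exact: twist_SLGK.
  exact: twist_SLWQK.
move=> S op; split=> [slwq|[bul [slg [Y [m [G [e [slgG opE]]]]]]]].
  exists (twist op); split; first exact: twist_SLWQ.
  have [Y [m [G [e [slg invK inv_tw]]]]] := SLWQ_twist_semilattice_of_groups slwq.
  exists Y, m, G, e; split=> // a x y y' Gy yy'.
  by rewrite -(group_invE slg Gy yy') inv_tw /twist invK.
(* Inverses in the given groups are the values of [groupoid_inv bul], so the hypothesis on [op]
   describes exactly the twist. *)
suff -> : op = twist bul by exact: twist_SLG.
apply/funext => x; apply/funext => y.
have [_ dec _] := slgG; have [a Gy] := decomposition_cover dec y.
exact: (opE _ _ _ _ Gy (group_inv slgG Gy)).
Qed.
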